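(* Let $(Z,d,\nu)$ be a metric measure space satisfying the LLC-1 condition, where $\nu$ is a doubling Borel regular measure. Let $E\subset Z$ be a bounded measurable set, and suppose that there exists $t>0$ such that $\overline{\mathcal{M}}^{-t}(\partial^+E)<\infty$. Then $\chi_E\in B^s_{1,1}(Z)$ for every $s\in(0,1)$ with $s<t$.
   Context: A measure $\nu$ is doubling if there is $C_\nu\ge1$ with $0<\nu(B(x,2r))\le C_\nu\,\nu(B(x,r))<\infty$ for all $x\in Z$, $r>0$. $Z$ satisfies the LLC-1 condition if there is $C_L\ge1$ such that for all $x\in Z$ and $r>0$, any two points of $B(x,r)$ can be joined by a connected set contained in $B(x,C_Lr)$. The regularized boundary $\partial^+E$ is the set of $x\in Z$ such that $\nu(B(x,r)\cap E)>0$ and $\nu(B(x,r)\setminus E)>0$ for all $r>0$. For $A\subset Z$, $t>0$, $r>0$, the codimension $t$ Minkowski $r$-content is $\mathcal{M}^{-t}_r(A)=\inf\{r^{-t}\sum_i\nu(B(x_i,r)): A\subset\bigcup_i B(x_i,r),\ x_i\in A\}$ (countable covers), and the codimension $t$ upper Minkowski content is $\overline{\mathcal{M}}^{-t}(A)=\limsup_{r\to0^+}\mathcal{M}^{-t}_r(A)$. For $0<s<1$, the Besov space $B^s_{1,1}(Z)$ consists of those $u\in L^1(Z)$ with $\|u\|_{B^s_{1,1}(Z)}=\int_Z\int_Z\frac{|u(y)-u(x)|}{d(x,y)^s\,\nu(B(x,d(x,y)))}\,d\nu(y)\,d\nu(x)<\infty$. *)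

(* Defs.v *)
From HB Require Import structures.
From mathcomp Require Import all_boot all_order all_algebra.
From mathcomp Require Import all_classical all_reals all_analysis.
Set Implicit Arguments. Unset Strict Implicit. Unset Printing Implicit Defensive.
Import Order.TTheory GRing.Theory Num.Theory.
Local Open Scope classical_set_scope.
Local Open Scope ring_scope.

Section MetricMeasure.
Context {R : realType} {Z : Type}.
Variable dist : Z -> Z -> R.

Definition is_metric : Prop :=
  (forall x y, 0 <= dist x y) /\ (forall x y, dist x y = 0 <-> x = y) /\
  (forall x y, dist x y = dist y x) /\
  (forall x y z, dist x z <= dist x y + dist y z).

Definition mball (x : Z) (r : R) : set Z := [set y | dist x y < r].

Definition mopen (U : set Z) : Prop :=
  forall x, U x -> exists2 r : R, 0 < r & mball x r `<=` U.

Definition mconnected (K : set Z) : Prop :=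
  forall U V : set Z, mopen U -> mopen V -> K `<=` U `|` V ->
    K `&` U `&` V = set0 -> K `&` U = set0 \/ K `&` V = set0.

Definition LLC1 : Prop :=
  exists2 CL : R, 1 <= CL &
    forall (x : Z) (r : R), 0 < r -> forall y z, mball x r y -> mball x r z ->
      exists K : set Z, [/\ mconnected K, K `<=` mball x (CL * r), K y & K z].

Definition mbounded (E : set Z) : Prop :=
  exists (x : Z) (r : R), E `<=` mball x r.

Definition mborel : set (set Z) := <<s mopen >>.

End MetricMeasure.

Section MeasureDefs.
Context {R : realType} {d0 : measure_display} {Z : measurableType d0}.
Variable dist : Z -> Z -> R.
Variable nu : {measure set Z -> \bar R}.

Local Open Scope ereal_scope.

Definition borel_regular : Prop :=
  (mborel dist `<=` measurable) /\
  (forall A : set Z, measurable A ->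
     exists B : set Z, [/\ mborel dist B, A `<=` B & nu B = nu A]).

Definition doubling : Prop :=
  exists2 C : R, (1 <= C)%R &
    forall (x : Z) (r : R), (0 < r)%R ->
      0 < nu (mball dist x (2 * r)) /\
      nu (mball dist x (2 * r)) <= C%:E * nu (mball dist x r) /\
      nu (mball dist x r) < +oo.

Definition reg_boundary (E : set Z) : set Z :=
  [set x | forall r : R, (0 < r)%R ->
     0 < nu (mball dist x r `&` E) /\ 0 < nu (mball dist x r `\` E)].

Definition mink_content (t r : R) (A : set Z) : \bar R :=
  ereal_inf [set v | exists (I : set nat) (x : nat -> Z),
     [/\ (forall i, I i -> A (x i)),
         A `<=` \bigcup_(i in I) mball dist (x i) r &
         v = (r `^ (- t))%:E * \esum_(i in I) nu (mball dist (x i) r)]].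

Definition upper_mink (t : R) (A : set Z) : \bar R :=
  ereal_inf [set ereal_sup [set mink_content t r A | r in [set r : R | (0 < r < delta)%R]]
            | delta in [set delta : R | (0 < delta)%R]].

Definition besov11 (s : R) (u : Z -> R) : Prop :=
  nu.-integrable setT (fun x => (u x)%:E) /\
  \int[nu]_x \int[nu]_y
     ((`|u y - u x| / (dist x y `^ s * fine (nu (mball dist x (dist x y)))))%:E)
  < +oo.

End MeasureDefs.

(* Main.v *)
(* If x and y lie on different sides of E then, outside a null set, the connected
   set joining them inside B(x, 2 CL d(x, y)) must meet the regularized boundary:
   otherwise the two open sets where E, resp. its complement, is locally null
   would disconnect it. Hence d(x, y) >= delta(x) / (2 CL), with delta the distance
   to the boundary, and summing the Besov kernel over dyadic shells around x bounds
   the inner integral by a multiple of delta(x)^(-s). The Minkowski content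
   gives nu {delta < r} <= K r^t for small r, so delta^(-s) is integrable near
   E because s < t. For x far from E one has d(x, y) ~ d(x, x0) by doubling, and
   the same shell estimate, now around x0, controls the outer integral. *)
Require Import Defs.
From HB Require Import structures.
From mathcomp Require Import all_boot all_order all_algebra.
From mathcomp Require Import all_classical all_reals all_analysis.
From mathcomp Require Import measurable_realfun ring lra.
Import Order.TTheory GRing.Theory Num.Theory.
Import numFieldNormedType.Exports HBNNSimple.
Local Open Scope classical_set_scope.
Local Open Scope ring_scope.

(** * Real powers *)

Lemma powR_expn {R : realType} (a s : R) j : 0 <= a -> (a ^+ j) `^ s = (a `^ s) ^+ j.
Proof.
by move=> a0; rewrite -!powR_mulrn ?powR_ge0// -!powRrM mulrC.
Qed.

Lemma powRV {R : realType} (a s : R) : 0 <= a -> a^-1 `^ s = (a `^ s)^-1.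
Proof. by move=> a0; rewrite -powR_inv1// -powRrM mulN1r powRN. Qed.

Lemma powR2_gt1 {R : realType} (s : R) : 0 < s -> (1 : R) < 2 `^ s.
Proof.
move=> s0; have := gt0_ltr_powR s0 (x := 1) (y := 2).
by rewrite powR1 !nnegrE; apply => //; lra.
Qed.

(** * Integrals of possibly non-measurable functions, and series of weighted indicators *)

Section Integral.
Context {R : realType} {d : measure_display} {T : measurableType d}.
Variable mu : {measure set T -> \bar R}.
Local Open Scope ereal_scope.

(* The integral of a nonnegative function is a supremum over simple functions
   below it, so [f] may be non-measurable. *)
Lemma le_integral_nonmeasurable (f g : T -> \bar R) :
  (forall x, 0 <= f x) -> (forall x, f x <= g x) ->
  \int[mu]_x f x <= \int[mu]_x g x.
Proof.
move=> f0 fg; have g0 x : 0 <= g x by exact: le_trans (f0 x) (fg x).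
rewrite !ge0_integralTE//; apply: ereal_sup_le => _ [h hf <-].
by exists h => //= x; apply: le_trans (fg x).
Qed.

(** Raising [g] to [+oo] on the null set makes the inequality hold everywhere and changes neither
    the measurability of [g] nor its integral. Since [f] may be non-measurable, it can be an inner
    integral as a function of the outer variable. *)
Lemma ae_le_integral_nonmeasurable (f g : T -> \bar R) :
  (forall x, 0 <= f x) -> (forall x, 0 <= g x) -> measurable_fun setT g ->
  {ae mu, forall x, f x <= g x} -> \int[mu]_x f x <= \int[mu]_x g x.
Proof.
move=> f0 g0 mg [N [mN N0 fgN]].
pose g' x := if x \in N then +oo else g x.
have mg' : measurable_fun setT g'.
  apply: measurable_fun_ifT => //.
  apply: (measurable_fun_bool true); rewrite setTI.
  rewrite (_ : _ @^-1` _ = N)//; apply/seteqP; split => x /=.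
    by move/set_mem.
  exact: mem_set.
have g'0 x : 0 <= g' x by rewrite /g'; case: ifPn.
apply: (@le_trans _ _ (\int[mu]_x g' x)).
  apply: le_integral_nonmeasurable => // x; rewrite /g'; case: ifPn => [_|xN].
    exact: leey.
  apply: contrapT => fg; move/negP: xN; apply; rewrite inE; exact: fgN.
rewrite le_eqVlt; apply/orP; left; apply/eqP.
apply: ge0_ae_eq_integral => //.
exists N; split => // x /= gg'; apply: contrapT => xN; apply: gg' => _.
by rewrite /g' memNset.
Qed.

(** Such series dominate the kernel and, near the boundary, the inner integral: they are measurable
    by construction and integrate term by term. *)
Definition step_series (b : nat -> R) (A : nat -> set T) (x : T) : \bar R :=
  \sum_(0 <= j <oo) (b j * \1_(A j) x)%:E.

Variables (b : nat -> R) (A : nat -> set T).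
Hypothesis b0 : forall j, (0 <= b j)%R.
Hypothesis mA : forall j, measurable (A j).

Let term_ge0 j x : 0 <= (b j * \1_(A j) x)%:E.
Proof. by rewrite lee_fin mulr_ge0. Qed.

Let mterm j : measurable_fun setT (fun x => (b j * \1_(A j) x)%:E).
Proof.
apply/measurable_EFinP; apply: measurable_funM => //.
Qed.

Lemma step_series_ge0 x : 0 <= step_series b A x.
Proof. by apply: nneseries_ge0. Qed.

Lemma measurable_step_series : measurable_fun setT (step_series b A).
Proof.
by apply: (@ge0_emeasurable_sum _ _ _ _ (fun j x => (b j * \1_(A j) x)%:E) predT).
Qed.

Lemma step_series_ge j x : A j x -> (b j)%:E <= step_series b A x.
Proof.
move=> Ax; rewrite -[leLHS](_ : (b j * \1_(A j) x)%:E = _); last first.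
  by rewrite indicE mem_set// mulr1.
apply: le_trans (nneseries_lim_ge j.+1 _) => //.
by rewrite big_nat_recr//= leeDr// sume_ge0.
Qed.

Lemma integral_step_series (K q : R) : (0 < q < 1)%R -> (0 <= K)%R ->
  (forall j, (b j)%:E * mu (A j) <= (K * q ^+ j)%:E) ->
  \int[mu]_x step_series b A x <= (K / (1 - q))%:E.
Proof.
move=> /andP[q0 q1] K0 bA; rewrite /step_series integral_nneseries//.
apply: (@le_trans _ _ (\sum_(0 <= j <oo) (K * q ^+ j)%:E)).
  apply: lee_nneseries => [j _ _|j _]; first exact: integral_ge0.
  rewrite (eq_integral (fun x => (b j)%:E * (\1_(A j) x)%:E)); last first.
    by move=> x _; rewrite EFinM.
  rewrite ge0_integralZl//; [|exact/measurable_EFinP|by rewrite lee_fin].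
  by rewrite integral_indic// setIT.
apply: lime_le; first by
  apply: is_cvg_nneseries => j _ _; rewrite lee_fin mulr_ge0// exprn_ge0// ltW.
apply: nearW => n; rewrite sumEFin lee_fin.
have := @geometric_le_lim R n K q K0 q0; rewrite (ger0_norm (ltW q0)) => /(_ q1).
by apply: le_trans; rewrite /series/=.
Qed.

End Integral.

(** * Balls in a doubling metric measure space *)

Section Space.
Context {R : realType} {d0 : measure_display} {Z : measurableType d0}.
Variables (dist : Z -> Z -> R) (nu : {measure set Z -> \bar R}).
Hypothesis dist_metric : is_metric dist.
Hypothesis borel_meas : mborel dist `<=` measurable.
Hypothesis nu_doubling : doubling dist nu.

Local Notation ball := (mball dist).

Let dist_ge0 x y : 0 <= dist x y.
Proof. by case: dist_metric. Qed.

Let distC x y : dist x y = dist y x.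
Proof. by case: dist_metric => _ [_ []]. Qed.

Let dist_tri x y z : dist x z <= dist x y + dist y z.
Proof. by case: dist_metric => _ [_ []]. Qed.

Let distxx x : dist x x = 0.
Proof. by case: dist_metric => _ [/(_ x x) []] _ ->. Qed.

Let dist_gt0 x y : x <> y -> 0 < dist x y.
Proof.
move=> xy; rewrite lt_neqAle dist_ge0 andbT; apply/eqP => /esym.
by case: dist_metric => _ [/(_ x y) []] + _ _ => /[apply].
Qed.

Lemma mball_open x r : mopen dist (ball x r).
Proof.
move=> y; rewrite /mball/= => xy; exists (r - dist x y); first by rewrite subr_gt0.
move=> z; rewrite /mball/= => yz; have := dist_tri x y z; lra.
Qed.

Lemma mopen_bigcup I (D : set I) (U : I -> set Z) :
  (forall i, D i -> mopen dist (U i)) -> mopen dist (\bigcup_(i in D) U i).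
Proof.
move=> oU x [i Di Uix]; have [r r0 rU] := oU i Di x Uix.
by exists r => // y /rU ?; exists i.
Qed.

Lemma mopen_measurable U : mopen dist U -> measurable U.
Proof. by move=> oU; apply: borel_meas; apply: sub_sigma_algebra. Qed.

Lemma mball_measurable x r : measurable (ball x r).
Proof. exact/mopen_measurable/mball_open. Qed.
Hint Resolve mball_measurable : core.

Lemma le_mball x y r r' : dist x y + r' <= r -> ball y r' `<=` ball x r.
Proof. by move=> h z; rewrite /mball/= => yz; have := dist_tri x y z; lra. Qed.

Lemma mball_gt0 x r : 0 < r -> (0 < nu (ball x r))%E.
Proof.
(* [doubling] states positivity at the doubled radius, hence [r / 2]. *)
move=> r0; have [C _ /(_ x (r / 2))[]] := nu_doubling; first by rewrite divr_gt0.
by rewrite mulrC divfK ?pnatr_eq0.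
Qed.

Lemma mball_fin x r : (nu (ball x r) < +oo)%E.
Proof.
have [r0|r0] := ltP 0 r; first by have [C _ /(_ x r r0)[_ []]] := nu_doubling.
rewrite (_ : ball x r = set0) ?measure0 ?ltry//.
by apply/seteqP; split => // y; rewrite /mball/=; have := dist_ge0 x y; lra.
Qed.

Local Notation mass x r := (fine (nu (ball x r))).

Lemma massE x r : (mass x r)%:E = nu (ball x r).
Proof. by rewrite fineK// ge0_fin_numE// mball_fin. Qed.

Lemma mass_gt0 x r : 0 < r -> 0 < mass x r.
Proof. by move=> r0; rewrite -lte_fin massE mball_gt0. Qed.

Lemma le_mass x y r r' : dist x y + r' <= r -> mass y r' <= mass x r.
Proof.
by move=> h; rewrite -lee_fin !massE le_measure ?inE//; exact: le_mball.
Qed.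

Lemma mass_doubling : exists2 C : R, 1 <= C &
  forall x r, 0 < r -> mass x (2 * r) <= C * mass x r.
Proof.
have [C C1 h] := nu_doubling; exists C => // x r r0.
by rewrite -lee_fin EFinM !massE; have [_ []] := h x r r0.
Qed.

(* Stands in for the Lindelöf property: finite unions of balls of radius [e]
   centred in [A] whose measures approach the supremum meet every other such
   ball, so that doubling their radii covers [A]. *)
Lemma negligible_uniform_balls (A G : set Z) x0 r0 e :
  A `<=` ball x0 r0 -> 0 < e ->
  (forall a, A a -> nu.-negligible (ball a (2 * e) `&` G)) ->
  nu.-negligible (A `&` G).
Proof.
move=> Ax0 e0 AG.
pose W r (s : seq {z | A z}) := \big[setU/set0]_(z <- s) ball (sval z) r.
have mW r s : measurable (W r s) by apply: bigsetU_measurable.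
have Wx0 s : W e s `<=` ball x0 (r0 + e).
  rewrite /W; elim: s => [|[a Aa] s IH]; first by rewrite big_nil.
  rewrite big_cons subUset; split => //=; apply: le_mball.
  by rewrite lerD2r ltW//; exact: (Ax0 _ Aa).
pose S := ereal_sup [set nu (W e s) | s in setT].
have S0 : (0 <= S)%E.
  by apply: ereal_sup_ubound; exists [::] => //; rewrite /W big_nil measure0.
have Sfin : S \is a fin_num.
  rewrite ge0_fin_numE//; apply: le_lt_trans (mball_fin x0 (r0 + e)).
  by apply: ge_ereal_sup => _ [s _ <-]; rewrite le_measure ?inE.
have [|u uS ucvg] := @ereal_sup_seq R [set nu (W e s) | s in setT].
  by apply/set0P; exists (nu (W e [::])), [::].
have /choice[s su] n : exists s, nu (W e s) = u n by have [s _ <-] := uS n; exists s.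
apply: (@negligibleS _ _ _ _ (\bigcup_n (W (2 * e) (s n) `&` G))).
  (* If [a] escapes all the doubled unions, its [e]-ball is disjoint from every [W e (s n)]. Adding
     this ball to the list gives [nu (ball a e) + u n <= S] for all [n], and the limit contradicts
     the positive mass of the ball. *)
  move=> a [Aa Ga]; apply: contrapT => aW.
  have disj n : ball a e `&` W e (s n) = set0.
    apply/seteqP; split => // y [ay sy]; apply: aW; exists n => //; split => //.
    move: sy; rewrite /W; elim: (s n) => [|[b Ab] s' IH]; rewrite ?big_nil// !big_cons.
    case=> [/= by_|/IH]; [left|by right].
    by move: ay by_; rewrite /mball/= (distC a); have := dist_tri b y a; lra.
  have le n : (nu (ball a e) + u n <= S)%E.
    rewrite -su -measureU//; apply: ereal_sup_ubound.
    by exists (exist _ a Aa :: s n) => //; rewrite /W big_cons.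
  have : (S <= S - nu (ball a e))%E.
    have {1}-> : S = limn u by rewrite (cvg_lim _ ucvg).
    apply: lime_le; first by apply/cvg_ex; exists S.
    by apply: nearW => n; rewrite leeBrDl// -massE.
  by rewrite -massE -(fineK Sfin) -EFinB lee_fin; have := mass_gt0 a e e0; lra.
apply: negligible_bigcup => n; rewrite /W; elim: (s n) => [|[a Aa] s' IH].
  by rewrite big_nil set0I; exact: negligible_set0.
by rewrite big_cons setIUl; apply: negligibleU => //; exact: AG.
Qed.

(** * Open sets where a given set is locally null *)

(** The complement of the support of [nu] restricted to [G]. *)
Definition null_interior (G : set Z) : set Z :=
  [set z | exists2 r, 0 < r & nu (ball z r `&` G) = 0%E].

Lemma null_interior_open G : measurable G -> mopen dist (null_interior G).
Proof.
move=> mG z [r r0 zr]; exists (r / 2); first by rewrite divr_gt0.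
move=> y zy; exists (r / 2); first by rewrite divr_gt0.
apply: subset_measure0 zr => //; [exact: measurableI|exact: measurableI|].
by apply: setSI; apply: le_mball; move: zy; rewrite /mball/=; lra.
Qed.

(** Countably many bounded pieces [A n], each with one radius that works for all its points, exhaust
    [null_interior G]; the uniform case applies to each. *)
Lemma null_interior_negligible G : measurable G ->
  nu.-negligible (null_interior G `&` G).
Proof.
move=> mG; have [x0|Z0] := pselect (exists x : Z, True); last first.
  by apply: negligibleS (negligible_set0 _) => x; case: Z0; exists x.
case: x0 => x0 _.
pose A n := [set z | ball x0 n%:R z /\ nu.-negligible (ball z (2 * n.+1%:R^-1) `&` G)].
apply: (@negligibleS _ _ _ _ (\bigcup_n (A n `&` G))); last first.
  apply: negligible_bigcup => n.
  apply: (@negligible_uniform_balls _ _ x0 n%:R n.+1%:R^-1) => [z []//||z []//].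
  by rewrite invr_gt0.
move=> z [[r r0 zr] Gz].
(* One [n] serves both purposes: [dist x0 z < n] and [2 / (n + 1) <= r]. *)
pose n := Num.bound (dist x0 z + 2 / r).
have : dist x0 z + 2 / r < n%:R.
  apply: archi_boundP; rewrite addr_ge0// divr_ge0// ltW//.
have r20 : 0 < 2 / r by rewrite divr_gt0.
have := dist_ge0 x0 z => d0' hn.
exists n => //; split => //; split; first by rewrite /mball/=; lra.
apply: (@negligibleS _ _ _ _ (ball z r `&` G)).
  apply: setSI; apply: le_mball; rewrite distxx add0r.
  rewrite ler_pdivrMr// mulrC -ler_pdivrMr// -natr1; lra.
by apply/negligibleP => //; exact: measurableI.
Qed.

(** * The regularized boundary separates the two sides of E *)

Section Boundary.
Variable E : set Z.
Hypothesis mE : measurable E.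
Local Notation bd := (reg_boundary dist nu E).

(** Around a common point some ball would be null both in [E] and in its complement, but balls have
    positive measure. *)
Lemma null_interior_disjoint :
  null_interior E `&` null_interior (~` E) = set0.
Proof.
apply/seteqP; split => // z [[r r0 zr] [r' r'0 zr']].
pose e := Num.min r r'; have e0 : 0 < e by rewrite lt_min r0.
have := mball_gt0 z e e0; rewrite -(setIT (ball z e)) -(setUv E) setIUr.
rewrite measureU//=; last 3 first.
- exact: measurableI.
- by apply: measurableI => //; exact: measurableC.
- by rewrite setIACA setICr setI0.
rewrite (@subset_measure0 _ _ _ nu _ (ball z r `&` E))//; last 3 first.
- exact: measurableI.
- exact: measurableI.
- by apply: setSI; apply: le_mball; rewrite distxx add0r ge_min lexx.
rewrite (@subset_measure0 _ _ _ nu _ (ball z r' `&` ~` E))//; last 3 first.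
- by apply: measurableI => //; exact: measurableC.
- by apply: measurableI => //; exact: measurableC.
- by apply: setSI; apply: le_mball; rewrite distxx add0r ge_min lexx orbT.
by rewrite adde0 ltxx.
Qed.

Lemma null_interior_cover z :
  [\/ bd z, null_interior E z | null_interior (~` E) z].
Proof.
have [|/existsNP[r /not_implyP[r0 /not_andP]]] := pselect (bd z); first by constructor 1.
rewrite setDE => -[] /negP; rewrite -leNgt measure_le0 => /eqP h.
  by constructor 2; exists r.
by constructor 3; exists r.
Qed.

Definition exceptional : set Z :=
  (null_interior E `&` E) `|` (null_interior (~` E) `&` ~` E).

Lemma exceptional_negligible : nu.-negligible exceptional.
Proof.
apply: negligibleU; apply: null_interior_negligible => //; exact: measurableC.
Qed.

Lemma boundary_between CL x y :
  1 <= CL ->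
  (forall (x : Z) (r : R), 0 < r -> forall y z, ball x r y -> ball x r z ->
    exists K : set Z, [/\ mconnected dist K, K `<=` ball x (CL * r), K y & K z]) ->
  ~ exceptional x -> ~ exceptional y -> \1_E x != \1_E y :> R ->
  exists2 a, bd a & dist a x < 2 * CL * dist x y.
Proof.
move=> CL1 llc xN yN xyE.
have xy : 0 < dist x y by apply: dist_gt0 => xy; rewrite xy eqxx in xyE.
have Cxy : dist x y <= CL * dist x y by rewrite ler_peMl// ltW.
have bx : bd x -> exists2 a, bd a & dist a x < 2 * CL * dist x y.
  by move=> ?; exists x => //; rewrite distxx -mulrA; lra.
have by_ : bd y -> exists2 a, bd a & dist a x < 2 * CL * dist x y.
  by move=> ?; exists y => //; rewrite (distC y) -mulrA; lra.
(* Balls are open, so [y] is not in the ball of radius [dist x y]; doubling that radius produces the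
   factor 2 in [2 * CL]. *)
have [K [Kc Kx xK yK]] : exists K : set Z,
    [/\ mconnected dist K, K `<=` ball x (CL * (2 * dist x y)), K x & K y].
  by apply: llc; rewrite /mball/= ?distxx; lra.
apply: contrapT => nbd.
have Kbd z : K z -> ~ bd z.
  move=> /Kx; rewrite /mball/= => xz bz; apply: nbd; exists z => //.
  by rewrite distC mulrAC mulrC mulrA [_ * 2]mulrC -mulrA mulrCA.
have [] := Kc (null_interior E) (null_interior (~` E)).
- exact: null_interior_open.
- exact/null_interior_open/measurableC.
- move=> z Kz; have [/(Kbd _ Kz)//| |] := null_interior_cover z; by [left|right].
- by rewrite -setIA null_interior_disjoint setI0.
- move=> KE.
  have side z : K z -> null_interior (~` E) z.
    move=> Kz; have [/(Kbd _ Kz)//|nz|//] := null_interior_cover z.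
    by have : set0 z by rewrite -KE.
  have inE z : K z -> ~ exceptional z -> E z.
    move=> /side nz zN; apply: contrapT => Ez; apply: zN; by right.
  by move: xyE; rewrite !indicE !mem_set ?eqxx//; exact: inE.
- move=> KE.
  have side z : K z -> null_interior E z.
    move=> Kz; have [/(Kbd _ Kz)//|//|nz] := null_interior_cover z.
    by have : set0 z by rewrite -KE.
  have outE z : K z -> ~ exceptional z -> ~ E z.
    move=> /side nz zN Ez; apply: zN; by left.
  by move: xyE; rewrite !indicE !memNset ?eqxx//; exact: outE.
Qed.

End Boundary.

(** * The Besov kernel and dyadic shells *)

Let kernel (s : R) x y := (dist x y `^ s * mass x (dist x y))^-1.

Let kernel_ge0 s x y : 0 <= kernel s x y.
Proof. by rewrite invr_ge0 mulr_ge0 ?powR_ge0// fine_ge0. Qed.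

(** The j-th coefficient bounds the kernel on the shell between radii [2 ^+ j * rho] and
    [2 ^+ j.+1 * rho]. Full balls replace the shells, since doubling controls their mass
    directly. *)
Definition shell_bound (s : R) x rho : Z -> \bar R :=
  step_series (fun j => ((2 ^+ j * rho) `^ s * mass x (2 ^+ j * rho))^-1)
              (fun j => ball x (2 ^+ j.+1 * rho)).

Let shell_coef_ge0 s x rho j :
  0 <= ((2 ^+ j * rho) `^ s * mass x (2 ^+ j * rho))^-1.
Proof. by rewrite invr_ge0 mulr_ge0 ?powR_ge0// fine_ge0. Qed.

Lemma shell_bound_ge0 s x rho y : (0 <= shell_bound s x rho y)%E.
Proof. exact: step_series_ge0. Qed.

Lemma measurable_shell_bound s x rho : measurable_fun setT (shell_bound s x rho).
Proof. exact: measurable_step_series. Qed.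

Lemma kernel_le_shell_bound s x y rho : 0 < s -> 0 < rho -> rho <= dist x y ->
  ((kernel s x y)%:E <= shell_bound s x rho y)%E.
Proof.
move=> s0 rho0 xy.
(* [j + 1] is the least exponent whose radius exceeds [dist x y]; it is not 0 because
   [rho <= dist x y]. *)
have [j /andP[jl ju]] : exists j, (2 ^+ j * rho <= dist x y < 2 ^+ j.+1 * rho).
  have ex : exists j, dist x y < 2 ^+ j * rho.
    exists (Num.bound (dist x y / rho)); rewrite -ltr_pdivrMr//.
    apply: lt_trans (archi_boundP _) _; first by rewrite divr_ge0// ltW.
    by rewrite -natrX ltr_nat ltn_expl.
  case: (ex_minnP ex) => -[|j] hj jmin; first by move: hj; rewrite mul1r; lra.
  by exists j; rewrite hj andbT leNgt; apply/negP => /jmin; rewrite ltnn.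
apply: le_trans (step_series_ge _ _ (shell_coef_ge0 s x rho) j y _) => //.
have p0 : 0 < 2 ^+ j * rho by rewrite mulr_gt0// exprn_gt0.
have d0' : 0 < dist x y by apply: lt_le_trans jl.
rewrite lee_fin lef_pV2 ?posrE ?mulr_gt0 ?powR_gt0 ?mass_gt0//.
rewrite ler_pM ?powR_ge0 ?fine_ge0//.
  by apply: (ge0_ler_powR (ltW s0)) => //; rewrite nnegrE ltW.
by apply: le_mass; rewrite distxx add0r.
Qed.

(** Doubling cancels the mass in each coefficient at the cost of [C], which leaves a geometric
    series of ratio 2^(-s). The constant depends neither on [x] nor on [rho]. *)
Lemma integral_shell_bound (s : R) : 0 < s -> exists2 A : R, 0 <= A &
  forall x rho, 0 < rho ->
    (\int[nu]_y shell_bound s x rho y <= (A * (rho `^ s)^-1)%:E)%E.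
Proof.
move=> s0; have [C C1 hC] := mass_doubling.
pose q : R := (2 `^ s)^-1.
have q0 : 0 < q by rewrite invr_gt0 powR_gt0.
have q1 : q < 1 by rewrite invf_lt1 ?powR_gt0// powR2_gt1.
exists (C / (1 - q)); first by rewrite divr_ge0; lra.
move=> x rho rho0; rewrite mulrAC.
apply: integral_step_series => //; first by rewrite q0.
- by rewrite divr_ge0 ?powR_ge0; lra.
- move=> j; have p0 : 0 < 2 ^+ j * rho by rewrite mulr_gt0// exprn_gt0.
  rewrite -(massE x (2 ^+ j.+1 * rho)) -EFinM lee_fin exprS -mulrA.
  apply: (@le_trans _ _ (((2 ^+ j * rho) `^ s * mass x (2 ^+ j * rho))^-1 *
                         (C * mass x (2 ^+ j * rho)))).
    by rewrite ler_pM2l ?hC// invr_gt0 mulr_gt0 ?powR_gt0 ?mass_gt0.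
  have m0 := mass_gt0 x _ p0.
  rewrite (powRM _ (exprn_ge0 _ _) (ltW rho0))// powR_expn// /q exprVn.
  rewrite le_eqVlt; apply/orP; left; apply/eqP.
  have : 2 `^ s != 0 by rewrite gt_eqF// powR_gt0.
  have : rho `^ s != 0 by rewrite gt_eqF// powR_gt0.
  move: m0; set m := mass _ _ => m0 rs0 ts0.
  by field; rewrite expf_neq0//= rs0 gt_eqF.
Qed.

(** * Neighbourhoods of a set and Minkowski content *)

(** The sublevel set of the distance to [S], written as a union of balls: it is open for every [S],
    and empty for empty [S]. *)
Definition collar (S : set Z) r : set Z := \bigcup_(a in S) ball a r.

Lemma collar_measurable S r : measurable (collar S r).
Proof. by apply/mopen_measurable/mopen_bigcup => a _; exact: mball_open. Qed.

(** Doubling the radii in a cover of [S] by [r]-balls yields a cover of the collar and multiplies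
    the total mass by at most [C]. *)
Lemma measure_collar_mink_content (t r M : R) S C : 0 < r ->
  (forall x r, 0 < r -> mass x (2 * r) <= C * mass x r) -> 0 <= C ->
  (mink_content dist nu t r S < M%:E)%E ->
  (nu (collar S r) <= (C * M * r `^ t)%:E)%E.
Proof.
move=> r0 hC C0 /ereal_inf_lt[_ [I [x [xS SI ->]]] ltM].
pose F i := if i \in I then ball (x i) (2 * r) else set0.
apply: (@le_trans _ _ (\sum_(0 <= i <oo) nu (F i))%E).
  apply: measure_sigma_subadditive.
  - by move=> i; rewrite /F; case: ifPn.
  - exact: collar_measurable.
  move=> z [a Sa az]; have [i Ii xa] := SI a Sa; exists i => //.
  rewrite /F mem_set//; move: az xa; rewrite /mball/=.
  by have := dist_tri (x i) a z; lra.
have sumC : (\esum_(i in I) nu (ball (x i) r) <= (M * r `^ t)%:E)%E.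
  move: ltM; rewrite powRN muleC -lte_pdivlMr ?invr_gt0 ?powR_gt0//.
  by rewrite invrK => /ltW.
apply: (@le_trans _ _ (C%:E * \esum_(i in I) nu (ball (x i) r)))%E; last first.
  by rewrite -mulrA EFinM; apply: lee_wpmul2l.
rewrite esum_mkcond -nneseries_esumT; last by move=> i; case: ifPn.
rewrite -nneseriesZl; last by move=> i _; case: ifPn.
apply: lee_nneseries => // i _; rewrite /F; case: ifPn => _.
  by rewrite -(massE _ (2 * r)) -(massE (x i) r) -EFinM lee_fin hC.
by rewrite measure0 mule0.
Qed.

Lemma measure_collar_upper_mink (t : R) S :
  (upper_mink dist nu t S < +oo)%E ->
  exists2 r0 : R, 0 < r0 & exists2 K : R, 0 <= K &
    forall r, 0 < r <= r0 -> (nu (collar S r) <= (K * r `^ t)%:E)%E.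
Proof.
move=> /ereal_inf_lt[_ [r1 /= r10 <-] ltM].
have [C C1 hC] := mass_doubling.
pose L := ereal_sup [set mink_content dist nu t r S | r in [set r | 0 < r < r1]].
have [M M0 LM] : exists2 M : R, 0 <= M & (L < M%:E)%E.
  move: ltM; rewrite -/L; case: L => [l| |]// _.
    by exists (Num.max 0 (l + 1)); rewrite ?le_max ?lexx// lte_fin lt_max; apply/orP; right; lra.
  by exists 0; rewrite ?lexx ?ltNyr.
(* The content is controlled for [r < r1] only, while the conclusion includes the endpoint. *)
exists (r1 / 2); first by rewrite divr_gt0.
exists (C * M); first by rewrite mulr_ge0; lra.
move=> r /andP[r0 rr1]; apply: measure_collar_mink_content => //; first by lra.
apply: le_lt_trans LM; apply: ereal_sup_ubound; exists r => //=.
by apply/andP; split; lra.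
Qed.

(** * The Besov energy of the characteristic function *)

Section CharacteristicFunction.
Variables (E : set Z) (s : R).
Hypotheses (mE : measurable E) (s0 : 0 < s).
Local Notation bd := (reg_boundary dist nu E).

Let integrand x y : \bar R :=
  (`|\1_E y - \1_E x| / (dist x y `^ s * mass x (dist x y)))%:E.

Let integrand_ge0 x y : (0 <= integrand x y)%E.
Proof. by rewrite lee_fin mulr_ge0 ?kernel_ge0. Qed.

Let integrand_eq0 x y : \1_E x = \1_E y :> R -> integrand x y = 0%E.
Proof. by rewrite /integrand => ->; rewrite subrr normr0 mul0r. Qed.

Let integrand_le x y : (integrand x y <= (kernel s x y)%:E)%E.
Proof.
rewrite lee_fin ler_piMl ?kernel_ge0// !indicE.
by do 2 case: (_ \in _); rewrite ?subrr ?sub0r ?subr0 ?normrN ?normr1 ?normr0.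
Qed.

(** For almost every [y] on the other side of [E], some boundary point [a] has rho <= d(a, x) < 2 CL
    d(x, y); for [y] on the same side the integrand is 0. *)
Lemma inner_integral_near CL x rho :
  1 <= CL ->
  (forall (x : Z) (r : R), 0 < r -> forall y z, ball x r y -> ball x r z ->
    exists K : set Z, [/\ mconnected dist K, K `<=` ball x (CL * r), K y & K z]) ->
  0 < rho -> ~ exceptional E x -> ~ collar bd rho x ->
  (\int[nu]_y integrand x y <= \int[nu]_y shell_bound s x (rho / (2 * CL)) y)%E.
Proof.
move=> CL1 llc rho0 xN xrho.
have CL0 : 0 < 2 * CL by lra.
apply: ae_le_integral_nonmeasurable.
- by move=> y; exact: integrand_ge0.
- by move=> y; exact: shell_bound_ge0.
- exact: measurable_shell_bound.
apply: negligibleS (exceptional_negligible E mE) => y /= yle.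
apply: contrapT => yN; apply: yle.
have [xy|xy] := eqVneq (\1_E x : R) (\1_E y).
  by rewrite integrand_eq0// shell_bound_ge0.
have [a ba ax] := boundary_between E mE CL x y CL1 llc xN yN xy.
apply: le_trans (integrand_le x y) _; apply: kernel_le_shell_bound => //.
  by rewrite divr_gt0.
rewrite ler_pdivrMr// mulrC; apply: le_trans (ltW ax).
by rewrite leNgt; apply/negP => ax'; apply: xrho; exists a.
Qed.

(** Only [y] in [E] contributes, and there the kernel at (x, y) is comparable to the kernel at (x0,
    x). Bounding the latter by [shell_bound] makes the bound measurable and integrable in [x]. *)
Lemma inner_integral_far x0 r : 0 < r -> E `<=` ball x0 r ->
  exists2 c : R, 0 <= c & forall x, 2 * r <= dist x0 x ->
  (\int[nu]_y integrand x y <= c%:E * shell_bound s x0 (2 * r) x)%E.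
Proof.
move=> r0 Er; have [C C1 hC] := mass_doubling.
(* The factor 2^s comes from d(x0, x) <= 2 d(x, y), and [C * C] from two doublings that enlarge the
   ball at [x] of radius d(x0, x) / 2 until it contains the ball at [x0] of radius d(x0, x). *)
pose c := C * C * 2 `^ s; have c0 : 0 <= c by rewrite mulr_ge0 ?powR_ge0// mulr_ge0; lra.
exists (c * mass x0 r); first by rewrite mulr_ge0// fine_ge0.
move=> x xr; have dx0 : 0 < dist x0 x by lra.
have xE : x \notin E.
  by apply/negP => /set_mem/Er; rewrite /mball/=; lra.
have ker y : E y -> kernel s x y <= c * kernel s x0 x.
  move=> /Er; rewrite /mball/= => yr.
  have dxy : dist x0 x / 2 <= dist x y.
    by have := dist_tri x0 y x; rewrite (distC y); lra.
  have dd0 : 0 < dist x0 x / 2 by lra.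
  have dxy0 : 0 < dist x y by lra.
  have le1 : mass x0 (dist x0 x) <= C * C * mass x (dist x y).
    have h1 := hC x _ dd0.
    have h2 := hC x (2 * (dist x0 x / 2)) ltac:(lra).
    have h3 : mass x0 (dist x0 x) <= mass x (2 * (2 * (dist x0 x / 2))).
      by apply: le_mass; rewrite distC; lra.
    have h4 : mass x (dist x0 x / 2) <= mass x (dist x y).
      by apply: le_mass; rewrite distxx add0r.
    apply: le_trans h3 _; apply: le_trans h2 _; rewrite -mulrA ler_wpM2l//; first by lra.
    by apply: le_trans h1 _; rewrite ler_wpM2l//; lra.
  have le2 : dist x0 x `^ s <= 2 `^ s * dist x y `^ s.
    rewrite -powRM//; apply: (ge0_ler_powR (ltW s0)); rewrite ?nnegrE; lra.
  have a0 : 0 < dist x y `^ s * mass x (dist x y) by rewrite mulr_gt0 ?powR_gt0 ?mass_gt0.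
  have b0 : 0 < dist x0 x `^ s * mass x0 (dist x0 x) by rewrite mulr_gt0 ?powR_gt0 ?mass_gt0.
  rewrite /kernel ler_pdivlMr// mulrC ler_pdivrMr//.
  apply: (le_trans (ler_pM (powR_ge0 _ _) (fine_ge0 (measure_ge0 _ _)) le2 le1)).
  by rewrite /c le_eqVlt; apply/orP; left; apply/eqP; ring.
apply: (@le_trans _ _ (\int[nu]_y ((c * kernel s x0 x)%:E * (\1_(ball x0 r) y)%:E))%E).
  apply: le_integral_nonmeasurable => // y.
  have [yE|yE] := boolP (y \in E).
    rewrite -EFinM [\1_(ball x0 r) y]indicE mem_set; last exact: Er (set_mem yE).
    rewrite mulr1; apply: le_trans (integrand_le x y) _; rewrite lee_fin.
    by apply: ker; exact: set_mem.
  rewrite integrand_eq0; last by rewrite !indicE (negbTE xE) (negbTE yE).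
  by rewrite -EFinM lee_fin mulr_ge0// mulr_ge0// kernel_ge0.
rewrite ge0_integralZl//; last 2 first.
- exact/measurable_EFinP.
- by rewrite lee_fin mulr_ge0// kernel_ge0.
rewrite integral_indic// setIT -(massE x0 r) -EFinM mulrAC EFinM.
apply: lee_wpmul2l; first by rewrite lee_fin mulr_ge0// fine_ge0.
by apply: kernel_le_shell_bound => //; lra.
Qed.

(** This intersection is the closure of [S], where the distance to [S] is 0 and no shell estimate is
    available; its measure is at most K r0^t 2^(-jt) for every [j]. *)
Lemma collars_negligible S (r0 K t : R) : 0 < r0 -> 0 < t ->
  (forall r, 0 < r <= r0 -> (nu (collar S r) <= (K * r `^ t)%:E)%E) ->
  nu.-negligible (\bigcap_j collar S (r0 / 2 ^+ j)).
Proof.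
move=> r00 t0 hK.
have r0j j : 0 < r0 / 2 ^+ j by rewrite divr_gt0// exprn_gt0.
have mN : measurable (\bigcap_j collar S (r0 / 2 ^+ j)).
  by apply: bigcapT_measurable => j; exact: collar_measurable.
apply/negligibleP => //; set N := \bigcap_j _.
have hj j : (nu N <= (geometric (K * r0 `^ t) (2 `^ t)^-1 j)%:E)%E.
  apply: (@le_trans _ _ (nu (collar S (r0 / 2 ^+ j)))).
    rewrite le_measure ?inE//; first exact: collar_measurable.
    by move=> x; apply.
  apply: le_trans (hK _ _) _.
    by rewrite r0j/= ler_piMr ?invf_le1 ?exprn_gt0// ?exprn_ege1 ?ler1n// ltW.
  rewrite lee_fin /= powRM ?invr_ge0 ?exprn_ge0// ?(ltW r00)//.
  by rewrite powRV ?exprn_ge0// powR_expn// exprVn mulrA.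
have Nfin : nu N \is a fin_num.
  by rewrite ge0_fin_numE//; apply: le_lt_trans (hj 0) _; rewrite ltry.
apply/eqP; rewrite eq_le measure_ge0 andbT -[leLHS](fineK Nfin) lee_fin.
have q1 : `|(2 `^ t)^-1 : R| < 1.
  by rewrite ger0_norm ?invr_ge0 ?powR_ge0// invf_lt1 ?powR_gt0// powR2_gt1.
have gcvg := @cvg_geometric R (K * r0 `^ t) _ q1.
rewrite -(cvg_lim _ gcvg)//; apply: limr_ge; first by apply/cvg_ex; exists 0.
by apply: nearW => j; rewrite -lee_fin fineK.
Qed.

Lemma double_integral_finite CL (t : R) x0 r :
  1 <= CL ->
  (forall (x : Z) (r : R), 0 < r -> forall y z, ball x r y -> ball x r z ->
    exists K : set Z, [/\ mconnected dist K, K `<=` ball x (CL * r), K y & K z]) ->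
  0 < r -> E `<=` ball x0 r -> s < t -> (upper_mink dist nu t bd < +oo)%E ->
  (\int[nu]_x \int[nu]_y integrand x y < +oo)%E.
Proof.
move=> CL1 llc r0 Er st mink.
have t0 : 0 < t by exact: lt_trans st.
have [rc rc0 [K K0 hK]] := measure_collar_upper_mink t bd mink.
have [A A0 hA] := integral_shell_bound s s0.
have [c c0 hc] := inner_integral_far x0 r r0 Er.
have CL0 : 0 < 2 * CL by lra.
have rj j : 0 < rc / 2 ^+ j by rewrite divr_gt0// exprn_gt0.
have near x rho : 0 < rho -> ~ exceptional E x -> ~ collar bd rho x ->
    (\int[nu]_y integrand x y <= (A * ((rho / (2 * CL)) `^ s)^-1)%:E)%E.
  move=> rho0 xN xrho; apply: le_trans (hA x _ _); last by rewrite divr_gt0.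
  exact: inner_integral_near.
(* [b j] bounds the inner integral at points in [B j] but not in [B j.+1], hence the index
   [j.+1]. *)
pose b j := A * ((rc / 2 ^+ j.+1 / (2 * CL)) `^ s)^-1.
have b0 j : 0 <= b j by rewrite mulr_ge0// invr_ge0 powR_ge0.
pose B j := collar bd (rc / 2 ^+ j).
have mB j : measurable (B j) by exact: collar_measurable.
(* [g1] serves the points of the first collar, [g2] the other points of [ball x0 (2 * r)], and [g3]
   the remaining far points. *)
pose c2 := A * ((rc / (2 * CL)) `^ s)^-1.
have c20 : 0 <= c2 by rewrite mulr_ge0// invr_ge0 powR_ge0.
pose g1 := step_series b B.
pose g2 x : \bar R := (c2%:E * (\1_(ball x0 (2 * r)) x)%:E)%E.
pose g3 x : \bar R := (c%:E * shell_bound s x0 (2 * r) x)%E.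
have g10 x : (0 <= g1 x)%E by exact: step_series_ge0.
have g20 x : (0 <= g2 x)%E by rewrite mule_ge0// lee_fin.
have g30 x : (0 <= g3 x)%E by rewrite mule_ge0// shell_bound_ge0.
have mg1 : measurable_fun setT g1 by exact: measurable_step_series.
have mind : measurable_fun setT (fun x => (\1_(ball x0 (2 * r)) x)%:E : \bar R).
  exact/measurable_EFinP.
have mg2 : measurable_fun setT g2 by exact: measurable_funeM.
have mg3 : measurable_fun setT g3.
  exact/measurable_funeM/measurable_shell_bound.
have mg12 : measurable_fun setT (g1 \+ g2)%E by exact: emeasurable_funD.
apply: (@le_lt_trans _ _ (\int[nu]_x ((g1 x + g2 x) + g3 x))%E).
  apply: ae_le_integral_nonmeasurable.
  - by move=> x; exact: integral_ge0.
  - by move=> x; rewrite !adde_ge0.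
  - exact: emeasurable_funD.
  have Nneg := negligibleU (exceptional_negligible E mE)
    (collars_negligible bd rc K t rc0 t0 hK).
  apply: negligibleS Nneg => x /= xle; apply: contrapT => /not_orP[xN xcol].
  apply: xle.
  have [xrc|xrc] := pselect (B 0%N x); last first.
    have [xr|xr] := ltP (dist x0 x) (2 * r).
      apply: (@le_trans _ _ (g2 x)); last by rewrite addeAC leeDr// adde_ge0.
      rewrite /g2 indicE mem_set// mule1; apply: near => //.
      by rewrite /B expr0 divr1 in xrc.
    apply: (@le_trans _ _ (g3 x)); last by rewrite leeDr// adde_ge0.
    exact: hc.
  apply: (@le_trans _ _ (g1 x)); last by rewrite -addeA leeDl// adde_ge0.
  (* Take the first collar that misses [x]. It is not [B 0], so [x] lies in its predecessor, whose
     term in [g1] suffices. *)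
  have ex : exists j, `[< ~ B j x >].
    apply: contrapT => nex; apply: xcol => j _; apply: contrapT => h.
    by apply: nex; exists j; apply/asboolP.
  case: (ex_minnP ex) => -[|j] /asboolP hj jmin //.
  have xB : B j x.
    by apply: contrapT => h; have := jmin j (introT (asboolP _) h); rewrite ltnn.
  by apply: le_trans (step_series_ge b B b0 j x xB); exact: near.
rewrite ge0_integralD//; last by move=> x _; rewrite adde_ge0.
rewrite ge0_integralD//; apply: lte_add_pinfty; first apply: lte_add_pinfty.
- have p2s : 0 < (2 : R) `^ s by rewrite powR_gt0.
  have p2t : 0 < (2 : R) `^ t by rewrite powR_gt0.
  (* The weights [b j] grow like 2^(js) and the collar measures are bounded by a multiple of
     2^(-jt), so s < t makes the series geometric. *)
  pose q : R := 2 `^ s / 2 `^ t.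
  have q0 : 0 < q by rewrite divr_gt0.
  have q1 : q < 1.
    rewrite ltr_pdivrMr// mul1r -[X in _ < _ `^ X](subrK s t) powRD ?pnatr_eq0 ?implybT//.
    by rewrite ltr_pMl// powR2_gt1// subr_gt0.
  (* The factor 2^s compensates for the index [j.+1] in [b j]. *)
  pose K' := A * K * rc `^ t * 2 `^ s / (rc / (2 * CL)) `^ s.
  have K'0 : 0 <= K' by rewrite !mulr_ge0 ?invr_ge0 ?powR_ge0.
  apply: le_lt_trans (integral_step_series nu b B b0 mB K' q _ K'0 _) _; last by rewrite ltry.
    by rewrite q0.
  move=> j; apply: (@le_trans _ _ ((b j)%:E * (K * (rc / 2 ^+ j) `^ t)%:E)%E).
    apply: lee_wpmul2l; first by rewrite lee_fin.
    by apply: hK; rewrite rj/= ler_piMr ?invf_le1 ?exprn_gt0// ?exprn_ege1 ?ler1n// ltW.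
  rewrite -EFinM lee_fin le_eqVlt; apply/orP; left; apply/eqP.
  rewrite /b /K' /q (mulrAC rc) !powRM ?invr_ge0 ?exprn_ge0 ?divr_ge0 ?(ltW rc0) ?(ltW CL0)//.
  rewrite !powRV ?exprn_ge0 ?(ltW CL0)// !powR_expn// exprMn exprVn exprS.
  have rs : rc `^ s != 0 by rewrite gt_eqF// powR_gt0.
  have cs : (2 * CL) `^ s != 0 by rewrite gt_eqF// powR_gt0.
  by field; rewrite rs cs !expf_neq0 gt_eqF.
- by rewrite ge0_integralZl// integral_indic// setIT -massE -EFinM ltry.
- rewrite ge0_integralZl//; last 2 first.
  + exact: measurable_shell_bound.
  + by move=> x _; exact: shell_bound_ge0.
  apply: (@le_lt_trans _ _ (c%:E * (A * ((2 * r) `^ s)^-1)%:E)%E).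
    by apply: lee_wpmul2l => //; apply: hA; lra.
  by rewrite -EFinM ltry.
Qed.

End CharacteristicFunction.
End Space.

Theorem theorem1p1 (R : realType) (d0 : measure_display) (Z : measurableType d0)
  (dist : Z -> Z -> R) (nu : {measure set Z -> \bar R}) (E : set Z) (t : R) :
  is_metric dist -> LLC1 dist -> doubling dist nu -> borel_regular dist nu ->
  measurable E -> mbounded dist E -> 0 < t ->
  (upper_mink dist nu t (reg_boundary dist nu E) < +oo)%E ->
  forall s : R, 0 < s -> s < 1 -> s < t -> besov11 dist nu s (\1_E).
Proof.
move=> dm [CL CL1 llc] dbl [borel _] mE [x0 [r Er]] _ mink s s0 _ st.
(* [mbounded] does not fix the sign of its radius. *)
pose r' := Num.max r 1.
have r'0 : 0 < r' by rewrite lt_max ltr01 orbT.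
have Er' : E `<=` mball dist x0 r'.
  by move=> x /Er; rewrite /mball/= => h; rewrite lt_max h.
split; last exact: double_integral_finite llc r'0 Er' st mink.
apply/integrableP; split; first exact/measurable_EFinP.
rewrite (eq_integral (fun x => (\1_E x)%:E)); last by move=> x _; rewrite gee0_abs ?lee_fin.
rewrite integral_indic// setIT; apply: le_lt_trans (mball_fin dist nu dm dbl x0 r').
by rewrite le_measure ?inE//; exact: mball_measurable.
Qed.
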